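(* Let $\mathbf{C}$ and $\mathbf{D}$ each be a small Heyting category that admits a generic monomorphism, let $\Box_{\mathbf{C}}:\mathbf{C}\to\mathbf{C}$ and $\Box_{\mathbf{D}}:\mathbf{D}\to\mathbf{D}$ be Cartesian comonads, and let $i:\Box_{\mathbf{C}}\hookrightarrow\Box_{\mathbf{D}}$ be a dense Cartesian full inclusion of Cartesian comonads which is, moreover, a logical inclusion. Then the categories of coalgebras $\mathbf{C}^{\Box_{\mathbf{C}}}$ and $\mathbf{D}^{\Box_{\mathbf{D}}}$ are again each a Heyting category that admits a generic monomorphism, and the Cartesian full subcategory inclusion $\mathbf{C}^{\Box_{\mathbf{C}}}\hookrightarrow\mathbf{D}^{\Box_{\mathbf{D}}}$ is dense and a logical inclusion.
   Context: A Cartesian category is a category equipped with a choice of finite limits; a Cartesian functor preserves finite limits; a Cartesian comonad is a comonad whose underlying functor is Cartesian. A full subcategory $\mathbf{C}$ of a Cartesian category $\mathbf{D}$ is a Cartesian full subcategory if it is closed under the chosen finite limits. Limits in categories of coalgebras for a Cartesian comonad are chosen so that the forgetful functor preserves the choice strictly. A Heyting category is a coherent category in which every pullback functor on subobjects has a right adjoint; a Heyting functor is one preserving this structure. A generic monomorphism is a monomorphism of which every monomorphism is a pullback. When $\mathbf{C},\mathbf{D}$ are Heyting categories each admitting a generic monomorphism, a Cartesian full subcategory inclusion $i:\mathbf{C}\hookrightarrow\mathbf{D}$ is a logical inclusion if it is a Heyting functor and preserves the generic monomorphism (sends a generic monomorphism of $\mathbf{C}$ to a generic monomorphism of $\mathbf{D}$).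 For $\mathbf{C}$ a Cartesian full subcategory of $\mathbf{D}$, a morphism $p:E\to B$ of $\mathbf{D}$ is called locally $\mathbf{C}$-small if for every $A\in\mathbf{C}$ and $f:A\to B$ there is a pullback of $p$ along $f$ with vertex in $\mathbf{C}$; by convention the chosen pullback $f^*E$ then lies in $\mathbf{C}$. A functor $F:\mathbf{C}\to\mathbf{D}$ between small categories is dense if for all $I,X\in\mathbf{D}$ the map $\mathrm{Hom}_{\mathbf{D}}(I,X)\to\mathrm{Nat}(\mathrm{Hom}_{\mathbf{D}}(F(-),I),\mathrm{Hom}_{\mathbf{D}}(F(-),X))$, $g\mapsto(f\mapsto g\circ f)$, is bijective. A Cartesian functor $G:\mathbf{D}\to\mathbf{F}$ is a morphism of sites $(\mathbf{D},\mathbf{C})\to(\mathbf{F},\mathbf{E})$, where $\mathbf{C}\subseteq\mathbf{D}$, $\mathbf{E}\subseteq\mathbf{F}$ are Cartesian full subcategories, if for every $D\in\mathbf{D}$ and $f:E\to GD$ in $\mathbf{F}$ with $E\in\mathbf{E}$ there is $g:C\to D$ in $\mathbf{D}$ with $C\in\mathbf{C}$ such that $f$ factors through $Gg$. A Cartesian full inclusion of Cartesian comonads $i:\Box_{\mathbf{C}}\hookrightarrow\Box_{\mathbf{D}}$ is a Cartesian full subcategory inclusion $i:\mathbf{C}\hookrightarrow\mathbf{D}$ that is a strict morphism of comonads: $i\Box_{\mathbf{C}}=\Box_{\mathbf{D}}i$, compatibly with counits and comultiplications. It induces the full subcategory inclusion $\mathbf{C}^{\Box_{\mathbf{C}}}\hookrightarrow\mathbf{D}^{\Box_{\mathbf{D}}}$,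 $(A,a)\mapsto(iA,ia)$. It is dense if $i:\mathbf{C}\hookrightarrow\mathbf{D}$ is a dense functor and $\Box_{\mathbf{D}}$ is a morphism of sites $(\mathbf{D},\mathbf{C})\to(\mathbf{D},\mathbf{C})$. It is a logical inclusion of Cartesian comonads if $i:\mathbf{C}\hookrightarrow\mathbf{D}$ is a logical inclusion. *)

(* Defs.v *)
From mathcomp Require Import ssreflect ssrfun ssrbool.
From Stdlib Require Import List ProofIrrelevance IndefiniteDescription.

Set Implicit Arguments.
Unset Strict Implicit.
Unset Printing Implicit Defensive.

Declare Scope cat_scope.
Delimit Scope cat_scope with cat.
Local Open Scope cat_scope.

Record Category := {
  Ob :> Type;
  Hom : Ob -> Ob -> Type;
  idc : forall A, Hom A A;
  compc : forall A B C, Hom B C -> Hom A B -> Hom A C;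
  comp1c : forall A B (f : Hom A B), compc (idc B) f = f;
  compc1 : forall A B (f : Hom A B), compc f (idc A) = f;
  compcA : forall A B C D (h : Hom C D) (g : Hom B C) (f : Hom A B),
    compc h (compc g f) = compc (compc h g) f }.

Arguments Hom {c} A B.
Arguments idc {c} A.
Arguments compc {c A B C} g f.

Notation "g ∘ f" := (compc g f) (at level 40, left associativity) : cat_scope.

Record Functor (C D : Category) := {
  fob :> C -> D;
  fmap : forall A B : C, Hom A B -> Hom (fob A) (fob B);
  fmap1 : forall A : C, fmap (idc A) = idc (fob A);
  fmapM : forall (A B E : C) (g : Hom B E) (f : Hom A B),
    fmap (g ∘ f) = fmap g ∘ fmap f }.

Arguments fmap {C D} f {A B} _ : rename.

Lemma comp_fmap1 (C D E : Category) (G : Functor D E) (F : Functor C D) A :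
  fmap G (fmap F (idc A)) = idc (G (F A)).
Proof. by rewrite !fmap1. Qed.

Lemma comp_fmapM (C D E : Category) (G : Functor D E) (F : Functor C D)
    (X Y Z : C) (g : Hom Y Z) (f : Hom X Y) :
  fmap G (fmap F (g ∘ f)) = fmap G (fmap F g) ∘ fmap G (fmap F f).
Proof. by rewrite !fmapM. Qed.

Definition comp_functor (C D E : Category) (G : Functor D E) (F : Functor C D) :
    Functor C E :=
  {| fob := fun A => G (F A);
     fmap := fun A B f => fmap G (fmap F f);
     fmap1 := comp_fmap1 G F;
     fmapM := comp_fmapM G F |}.

(* The identity of x regarded as a morphism x -> y along an equality of
   objects.  An equation between morphisms that is only well typed up to an
   equality of objects is stated by composing with such an identity. *)
Definition eq_hom (C : Category) (x y : C) (e : x = y) : Hom x y :=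
  match e in _ = z return Hom x z with eq_refl => idc x end.

Record Cone (J C : Category) (T : Functor J C) := {
  apex :> C;
  leg : forall j : J, Hom apex (T j);
  leg_nat : forall (j k : J) (u : Hom j k), fmap T u ∘ leg j = leg k }.

Definition is_limit (J C : Category) (T : Functor J C) (c : Cone T) : Prop :=
  forall d : Cone T, exists! h : Hom (apex d) (apex c),
    forall j, leg c j ∘ h = leg d j.

Lemma map_cone_nat (J C D : Category) (F : Functor C D) (T : Functor J C)
    (c : Cone T) (j k : J) (u : Hom j k) :
  fmap F (fmap T u) ∘ fmap F (leg c j) = fmap F (leg c k).
Proof. by rewrite -fmapM leg_nat. Qed.

Definition map_cone (J C D : Category) (F : Functor C D) (T : Functor J C)
    (c : Cone T) : Cone (comp_functor F T) :=
  {| apex := F c;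
     leg := fun j => fmap F (leg c j) : Hom (F c) (comp_functor F T j);
     leg_nat := map_cone_nat F c |}.

Definition finite_type (X : Type) : Prop := exists l : list X, forall x, In x l.

Definition finite_category (J : Category) : Prop :=
  finite_type J /\ forall j k : J, finite_type (Hom j k).

Record CartesianCategory := {
  cart_cat :> Category;
  lim : forall J : Category, finite_category J ->
        forall T : Functor J cart_cat, Cone T;
  lim_is_limit : forall J (finJ : finite_category J) (T : Functor J cart_cat),
    is_limit (lim finJ T) }.

Arguments lim {c J} finJ T : rename.
Arguments lim_is_limit {c J} finJ T : rename.

Definition cartesian_functor (C D : Category) (F : Functor C D) : Prop :=
  forall J : Category, finite_category J ->
  forall (T : Functor J C) (c : Cone T), is_limit c -> is_limit (map_cone F c).

Definition strictly_preserves_lim (C D : CartesianCategory) (F : Functor C D) :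
    Prop :=
  forall (J : Category) (finJ : finite_category J) (T : Functor J C),
  exists e : F (lim finJ T) = lim finJ (comp_functor F T),
  forall j, leg (lim finJ (comp_functor F T)) j ∘ eq_hom e
            = fmap F (leg (lim finJ T) j).

(* A full subcategory is presented by its inclusion functor, that is, by a
   fully faithful functor that is injective on objects; it is closed under the
   chosen limits when the choice in C is the restriction of the choice in D. *)
Record cartesian_full_inclusion (C D : CartesianCategory) (i : Functor C D) :
    Prop := {
  incl_inj : injective (fob i);
  incl_full_faithful : forall A B : C, bijective (@fmap C D i A B);
  incl_lim : strictly_preserves_lim i }.

Definition mono (C : Category) (A B : C) (m : Hom A B) : Prop :=
  forall (X : C) (u v : Hom X A), m ∘ u = m ∘ v -> u = v.

(* The square with q on top, p on the left, f at the bottom and g on the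
   right: p is the pullback of g along f, and q is that of f along g. *)
Definition is_pullback (C : Category) (A B X P : C)
    (f : Hom A X) (g : Hom B X) (p : Hom P A) (q : Hom P B) : Prop :=
  f ∘ p = g ∘ q /\
  forall (Z : C) (u : Hom Z A) (v : Hom Z B), f ∘ u = g ∘ v ->
  exists! w : Hom Z P, p ∘ w = u /\ q ∘ w = v.

Definition factors_through (C : Category) (A B X : C)
    (f : Hom A X) (m : Hom B X) : Prop :=
  exists h : Hom A B, m ∘ h = f.

(* Subobjects of X are represented by monomorphisms into X, preordered by
   factors_through. *)
Record Sub (C : Category) (X : C) := {
  sub_ob : C;
  sub_arr :> Hom sub_ob X;
  sub_mono : mono sub_arr }.

Definition is_image (C : Category) (A B I : C) (f : Hom A B) (m : Hom I B) :
    Prop :=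
  [/\ mono m, factors_through f m &
      forall (I' : C) (m' : Hom I' B),
        mono m' -> factors_through f m' -> factors_through m m'].

Definition is_bottom (C : Category) (X Z : C) (z : Hom Z X) : Prop :=
  mono z /\
  forall (A : C) (m : Hom A X), mono m -> factors_through z m.

Definition is_union (C : Category) (X A B U : C)
    (m : Hom A X) (n : Hom B X) (u : Hom U X) : Prop :=
  [/\ mono u, factors_through m u, factors_through n u &
      forall (V : C) (v : Hom V X), mono v ->
        factors_through m v -> factors_through n v -> factors_through u v].

(* r is the value at the subobject s of a right adjoint to pullback of
   subobjects along f. *)
Definition is_dual_image (C : Category) (A B S R : C)
    (f : Hom A B) (s : Hom S A) (r : Hom R B) : Prop :=
  mono r /\
  forall (T P : C) (t : Hom T B) (p : Hom P A) (q : Hom P T),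
    mono t -> is_pullback f t p q ->
    (factors_through p s <-> factors_through t r).

Record coherent_category (C : CartesianCategory) : Prop := {
  coh_image : forall (A B : C) (f : Hom A B), exists M : Sub B, is_image f M;
  coh_image_stable :
    forall (A B I B' A' I' : C) (f : Hom A B) (m : Hom I B) (g : Hom B' B)
      (f' : Hom A' B') (a : Hom A' A) (m' : Hom I' B') (b : Hom I' I),
    is_image f m -> is_pullback g f f' a -> is_pullback g m m' b ->
    is_image f' m';
  coh_bottom : forall X : C, exists Z : Sub X, is_bottom Z;
  coh_bottom_stable :
    forall (X X' Z Z' : C) (z : Hom Z X) (g : Hom X' X)
      (z' : Hom Z' X') (q : Hom Z' Z),
    is_bottom z -> is_pullback g z z' q -> is_bottom z';
  coh_union : forall (X : C) (M N : Sub X), exists U : Sub X, is_union M N U;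
  coh_union_stable :
    forall (X X' A B U A' B' U' : C) (g : Hom X' X)
      (m : Hom A X) (n : Hom B X) (u : Hom U X)
      (m' : Hom A' X') (n' : Hom B' X') (u' : Hom U' X')
      (a : Hom A' A) (b : Hom B' B) (c : Hom U' U),
    mono m -> mono n -> is_union m n u ->
    is_pullback g m m' a -> is_pullback g n n' b -> is_pullback g u u' c ->
    is_union m' n' u' }.

Record heyting_category (C : CartesianCategory) : Prop := {
  heyting_coherent : coherent_category C;
  heyting_right_adjoint : forall (A B : C) (f : Hom A B),
    exists forall_f : Sub A -> Sub B,
    forall S : Sub A, is_dual_image f S (forall_f S) }.

Record heyting_functor (C D : CartesianCategory) (F : Functor C D) : Prop := {
  heyting_cartesian : cartesian_functor F;
  heyting_image : forall (A B I : C) (f : Hom A B) (m : Hom I B),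
    is_image f m -> is_image (fmap F f) (fmap F m);
  heyting_bottom : forall (X Z : C) (z : Hom Z X),
    is_bottom z -> is_bottom (fmap F z);
  heyting_union : forall (X A B U : C)
      (m : Hom A X) (n : Hom B X) (u : Hom U X),
    mono m -> mono n -> is_union m n u ->
    is_union (fmap F m) (fmap F n) (fmap F u);
  heyting_dual_image : forall (A B S R : C)
      (f : Hom A B) (s : Hom S A) (r : Hom R B),
    mono s -> is_dual_image f s r ->
    is_dual_image (fmap F f) (fmap F s) (fmap F r) }.

Definition generic_mono (C : Category) (U V : C) (t : Hom U V) : Prop :=
  mono t /\
  forall (A B : C) (m : Hom A B), mono m ->
  exists (f : Hom B V) (g : Hom A U), is_pullback f t m g.

Definition has_generic_mono (C : Category) : Prop :=
  exists (U V : C) (t : Hom U V), generic_mono t.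

Record logical_inclusion (C D : CartesianCategory) (i : Functor C D) : Prop := {
  logical_incl : cartesian_full_inclusion i;
  logical_heyting : heyting_functor i;
  logical_generic : forall (U V : C) (t : Hom U V),
    generic_mono t -> generic_mono (fmap i t) }.

(* Nat(Hom_D(F(-), I), Hom_D(F(-), X)) *)
Record HomNat (C D : Category) (F : Functor C D) (I X : D) := {
  hn_fun :> forall A : C, Hom (F A) I -> Hom (F A) X;
  hn_nat : forall (A B : C) (h : Hom A B) (f : Hom (F B) I),
    hn_fun (f ∘ fmap F h) = hn_fun f ∘ fmap F h }.

Definition postcomp (C D : Category) (F : Functor C D) (I X : D) (g : Hom I X) :
    HomNat F I X :=
  {| hn_fun := fun A f => g ∘ f;
     hn_nat := fun A B h f => compcA g f (fmap F h) |}.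

Definition dense_functor (C D : Category) (F : Functor C D) : Prop :=
  forall I X : D, bijective (@postcomp C D F I X).

(* The full subcategories of D and F are presented by their inclusions i, k. *)
Definition site_morphism (C D E F : CartesianCategory)
    (i : Functor C D) (k : Functor E F) (G : Functor D F) : Prop :=
  cartesian_functor G /\
  forall (X : D) (A : E) (f : Hom (k A) (G X)),
  exists (B : C) (g : Hom (i B) X), factors_through f (fmap G g).

Record Comonad (C : Category) := {
  box :> Functor C C;
  counit : forall A : C, Hom (box A) A;
  comult : forall A : C, Hom (box A) (box (box A));
  counit_nat : forall (A B : C) (f : Hom A B),
    counit B ∘ fmap box f = f ∘ counit A;
  comult_nat : forall (A B : C) (f : Hom A B),
    comult B ∘ fmap box f = fmap box (fmap box f) ∘ comult A;
  counit_comult : forall A, counit (box A) ∘ comult A = idc (box A);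
  map_counit_comult : forall A, fmap box (counit A) ∘ comult A = idc (box A);
  comult_comult : forall A,
    comult (box A) ∘ comult A = fmap box (comult A) ∘ comult A }.

Arguments counit {C} c A.
Arguments comult {C} c A.

Record CartesianComonad (C : CartesianCategory) := {
  cart_comonad :> Comonad C;
  cart_comonad_cartesian : cartesian_functor cart_comonad }.

Arguments cart_comonad_cartesian {C} W {J} finJ {T c} _ : rename.

Record Coalgebra (C : Category) (W : Comonad C) := {
  carrier :> C;
  coact : Hom carrier (W carrier);
  coact_counit : counit W carrier ∘ coact = idc carrier;
  coact_comult : comult W carrier ∘ coact = fmap W coact ∘ coact }.

Record CoalgHom (C : Category) (W : Comonad C) (A B : Coalgebra W) := {
  coalg_arr :> Hom A B;
  coalg_arrP : fmap W coalg_arr ∘ coact A = coact B ∘ coalg_arr }.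

Section CoalgebraCategory.
Variables (C : Category) (W : Comonad C).

Lemma coalg_hom_eq (A B : Coalgebra W) (f g : CoalgHom A B) :
  coalg_arr f = coalg_arr g -> f = g.
Proof.
case: f g => [f Hf] [g Hg] /= E; subst g.
by rewrite (proof_irrelevance _ Hf Hg).
Qed.

Lemma coalg_idP (A : Coalgebra W) :
  fmap W (idc A) ∘ coact A = coact A ∘ idc A.
Proof. by rewrite fmap1 comp1c compc1. Qed.

Lemma coalg_compP (A B E : Coalgebra W) (g : CoalgHom B E) (f : CoalgHom A B) :
  fmap W (g ∘ f) ∘ coact A = coact E ∘ (g ∘ f).
Proof. by rewrite fmapM -compcA coalg_arrP compcA coalg_arrP compcA. Qed.

Definition coalg_id (A : Coalgebra W) : CoalgHom A A :=
  {| coalg_arr := idc A; coalg_arrP := coalg_idP A |}.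

Definition coalg_comp (A B E : Coalgebra W)
    (g : CoalgHom B E) (f : CoalgHom A B) : CoalgHom A E :=
  {| coalg_arr := g ∘ f; coalg_arrP := coalg_compP g f |}.

Definition Coalg : Category.
Proof.
refine {| Ob := Coalgebra W; Hom := @CoalgHom C W;
          idc := coalg_id; compc := coalg_comp |}.
- by move=> A B f; apply: coalg_hom_eq; apply: comp1c.
- by move=> A B f; apply: coalg_hom_eq; apply: compc1.
- by move=> A B E F h g f; apply: coalg_hom_eq; apply: compcA.
Defined.

Definition forget : Functor Coalg C :=
  {| fob := fun A : Coalg => carrier A;
     fmap := fun (A B : Coalg) (f : Hom A B) => coalg_arr f;
     fmap1 := fun A => eq_refl;
     fmapM := fun A B E g f => eq_refl |}.

End CoalgebraCategory.

(* Chosen finite limits of coalgebras are strictly preserved by forget: the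
   carrier and the legs are those of the chosen limit of the underlying
   diagram; the coalgebra structure is the unique one for which the legs are
   homomorphisms, and it exists because the comonad preserves the limit. *)

Lemma limit_ext (J C : Category) (T : Functor J C) (c : Cone T) (X : C)
    (u v : Hom X (apex c)) :
  is_limit c -> (forall j, leg c j ∘ u = leg c j ∘ v) -> u = v.
Proof.
move=> Hc E.
have N : forall (j k : J) (w : Hom j k),
    fmap T w ∘ (leg c j ∘ v) = leg c k ∘ v.
  by move=> j k w; rewrite compcA leg_nat.
have [h [_ Hh]] :=
  Hc {| apex := X; leg := fun j => leg c j ∘ v; leg_nat := N |}.
by rewrite -(Hh u E) -(Hh v (fun j => eq_refl)).
Qed.

Section CoalgebraLimits.
Variables (C : CartesianCategory) (W : CartesianComonad C).
Variables (J : Category) (finJ : finite_category J).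
Variable T : Functor J (Coalg W).

Let UT : Functor J C := comp_functor (forget W) T.
Let L : Cone UT := lim finJ UT.

Let boxL_limit : is_limit (map_cone W L) :=
  cart_comonad_cartesian W finJ (lim_is_limit finJ UT).

Let boxboxL_limit : is_limit (map_cone W (map_cone W L)) :=
  cart_comonad_cartesian W finJ boxL_limit.

Lemma coact_cone_nat (j k : J) (u : Hom j k) :
  fmap W (fmap UT u) ∘ (coact (T j) ∘ leg L j)
  = coact (T k) ∘ leg L k.
Proof.
rewrite /= compcA coalg_arrP -compcA; congr (_ ∘ _).
exact: (leg_nat L u).
Qed.

Definition coact_cone : Cone (comp_functor W UT) :=
  {| apex := L;
     leg := fun j => coact (T j) ∘ leg L j : Hom L (comp_functor W UT j);
     leg_nat := coact_cone_nat |}.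

Definition lim_coact_sig :
  {h : Hom L (W L) |
    forall j, fmap W (leg L j) ∘ h = coact (T j) ∘ leg L j}.
Proof.
apply: constructive_indefinite_description.
by have [h [Hh _]] := boxL_limit coact_cone; exists h.
Defined.

Definition lim_coact : Hom L (W L) := proj1_sig lim_coact_sig.

Lemma lim_coactP j : fmap W (leg L j) ∘ lim_coact = coact (T j) ∘ leg L j.
Proof. exact: (proj2_sig lim_coact_sig). Qed.

Lemma lim_coact_counit : counit W L ∘ lim_coact = idc L.
Proof.
apply: (limit_ext (c := L) (lim_is_limit finJ UT)) => j.
rewrite -/L compcA -counit_nat -compcA lim_coactP compcA.
by rewrite coact_counit comp1c compc1.
Qed.

Lemma lim_coact_comult :
  comult W L ∘ lim_coact = fmap W lim_coact ∘ lim_coact.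
Proof.
apply: (limit_ext boxboxL_limit) => j /=.
rewrite compcA -comult_nat -compcA lim_coactP compcA coact_comult.
by rewrite compcA -fmapM lim_coactP fmapM -!compcA lim_coactP.
Qed.

Definition lim_coalg : Coalg W :=
  {| carrier := L; coact := lim_coact;
     coact_counit := lim_coact_counit; coact_comult := lim_coact_comult |}.

Definition lim_coalg_leg (j : J) : Hom lim_coalg (T j) :=
  {| coalg_arr := leg L j : Hom (carrier lim_coalg) (carrier (T j));
     coalg_arrP := lim_coactP j |}.

Lemma lim_coalg_nat (j k : J) (u : Hom j k) :
  fmap T u ∘ lim_coalg_leg j = lim_coalg_leg k.
Proof. by apply: coalg_hom_eq; exact: (leg_nat L u). Qed.

Definition lim_coalg_cone : Cone T :=
  {| apex := lim_coalg; leg := lim_coalg_leg; leg_nat := lim_coalg_nat |}.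

Lemma lim_coalg_is_limit : is_limit lim_coalg_cone.
Proof.
move=> d.
have [h [Hh Uh]] := lim_is_limit finJ UT (map_cone (forget W) d).
have hP : fmap W h ∘ coact (apex d) = coact lim_coalg ∘ h.
  apply: (limit_ext boxL_limit) => j /=.
  rewrite !compcA -fmapM Hh lim_coactP /= coalg_arrP -compcA.
  by congr (_ ∘ _); exact: (esym (Hh j)).
exists {| coalg_arr := h : Hom (carrier (apex d)) (carrier lim_coalg);
          coalg_arrP := hP |}; split.
- by move=> j; apply: coalg_hom_eq; exact: (Hh j).
- move=> g Hg; apply: coalg_hom_eq; apply: Uh => j.
  exact: (f_equal (@coalg_arr _ _ _ _) (Hg j)).
Qed.

End CoalgebraLimits.

Definition CartCoalg (C : CartesianCategory) (W : CartesianComonad C) :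
    CartesianCategory :=
  {| cart_cat := Coalg W;
     lim := fun J finJ T => lim_coalg_cone finJ T;
     lim_is_limit := fun J finJ T => @lim_coalg_is_limit C W J finJ T |}.

(* scm_ob and scm_map together say that i WC = WD i as functors. *)
Record strict_comonad_morphism (C D : Category) (WC : Comonad C)
    (WD : Comonad D) (i : Functor C D) : Prop := {
  scm_ob : forall A : C, i (WC A) = WD (i A);
  scm_map : forall (A B : C) (f : Hom A B),
    fmap WD (fmap i f) ∘ eq_hom (scm_ob A)
    = eq_hom (scm_ob B) ∘ fmap i (fmap WC f);
  scm_counit : forall A : C,
    counit WD (i A) ∘ eq_hom (scm_ob A) = fmap i (counit WC A);
  scm_comult : forall A : C,
    comult WD (i A) ∘ eq_hom (scm_ob A)
    = fmap WD (eq_hom (scm_ob A)) ∘ eq_hom (scm_ob (WC A))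
      ∘ fmap i (comult WC A) }.

Record ComonadInclusion (C D : CartesianCategory)
    (WC : CartesianComonad C) (WD : CartesianComonad D) := {
  cincl :> Functor C D;
  cincl_full : cartesian_full_inclusion cincl;
  cincl_strict : strict_comonad_morphism WC WD cincl }.

Definition dense_comonad_inclusion (C D : CartesianCategory)
    (WC : CartesianComonad C) (WD : CartesianComonad D)
    (i : ComonadInclusion WC WD) : Prop :=
  dense_functor i /\ site_morphism i i WD.

Definition logical_comonad_inclusion (C D : CartesianCategory)
    (WC : CartesianComonad C) (WD : CartesianComonad D)
    (i : ComonadInclusion WC WD) : Prop :=
  logical_inclusion i.

Section CoalgebraInclusion.
Variables (C D : Category) (WC : Comonad C) (WD : Comonad D).
Variables (i : Functor C D) (Hi : strict_comonad_morphism WC WD i).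

Definition incl_coact (A : Coalgebra WC) : Hom (i A) (WD (i A)) :=
  eq_hom (scm_ob Hi A) ∘ fmap i (coact A).

Lemma incl_coact_counit (A : Coalgebra WC) : counit WD (i A) ∘ incl_coact A = idc (i A).
Proof. by rewrite /incl_coact compcA scm_counit -fmapM coact_counit fmap1. Qed.

Lemma incl_coact_comult (A : Coalgebra WC) :
  comult WD (i A) ∘ incl_coact A = fmap WD (incl_coact A) ∘ incl_coact A.
Proof.
rewrite /incl_coact compcA scm_comult -compcA -fmapM coact_comult !fmapM.
by rewrite -!compcA; congr (_ ∘ _); rewrite !compcA scm_map.
Qed.

Definition incl_coalg (A : Coalg WC) : Coalg WD :=
  {| carrier := i (carrier A); coact := incl_coact A;
     coact_counit := incl_coact_counit A;
     coact_comult := incl_coact_comult A |}.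

Lemma incl_coalg_homP (A B : Coalg WC) (f : Hom A B) :
  fmap WD (fmap i (coalg_arr f)) ∘ coact (incl_coalg A)
  = coact (incl_coalg B) ∘ fmap i (coalg_arr f).
Proof.
rewrite /= /incl_coact compcA scm_map -!compcA; congr (_ ∘ _).
by rewrite -!fmapM coalg_arrP.
Qed.

Definition incl_coalg_hom (A B : Coalg WC) (f : Hom A B) :
    Hom (incl_coalg A) (incl_coalg B) :=
  {| coalg_arr := fmap i (coalg_arr f)
       : Hom (carrier (incl_coalg A)) (carrier (incl_coalg B));
     coalg_arrP := incl_coalg_homP f |}.

Definition incl_coalg_functor : Functor (Coalg WC) (Coalg WD).
Proof.
refine {| fob := incl_coalg; fmap := incl_coalg_hom |}.
- by move=> A; apply: coalg_hom_eq; apply: fmap1.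
- by move=> A B E g f; apply: coalg_hom_eq; apply: fmapM.
Defined.

End CoalgebraInclusion.

Definition coalg_inclusion (C D : CartesianCategory)
    (WC : CartesianComonad C) (WD : CartesianComonad D)
    (i : ComonadInclusion WC WD) : Functor (CartCoalg WC) (CartCoalg WD) :=
  incl_coalg_functor (cincl_strict i).

(* Main.v *)
From mathcomp Require Import ssreflect ssrfun ssrbool.
From Stdlib Require Import ProofIrrelevance IndefiniteDescription
  FunctionalExtensionality.
Require Import Defs.

Set Implicit Arguments.
Unset Strict Implicit.
Unset Printing Implicit Defensive.

Local Open Scope cat_scope.

(** The structure on coalgebras is read off from carriers.  The forgetful
    functor to the base category preserves finite limits, so pullbacks and
    monomorphisms of coalgebras are recognized on carriers, and a subobject of
    a coalgebra B is a subobject m of its carrier with m <= j(m), where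
    j(m) = b^*(W m) is the pullback of W m along the coaction b: B -> W B.
    This pullback may be formed among coalgebras, as that of a map of cofree
    coalgebras along b, so j(m) is always a subcoalgebra; it is the largest one
    contained in m, the interior of m ([interior_factors],
    [interior_universal]).

    - Images, the bottom and unions are least subobjects with a property that
      passes from m to j(m).  The least one is then below its own interior,
      hence a subcoalgebra, so these three are computed on carriers
      ([least_exists], [least_iff]).
    - A dual image of coalgebras is the interior of the dual image of carriers
      ([coalg_dual_image]).
    - If t is a generic monomorphism, so is the map W t of cofree coalgebras:
      when m is the pullback of t along x, the transpose W x o b classifies
      the subcoalgebra m, because its pullback of W t is j(m) = m
      ([cofree_generic]).

    The functor F induced by i on coalgebras commutes with these recipes, since
    i commutes with their ingredients; this gives the logical inclusion.  Limits
    of coalgebras are chosen on carriers, so F preserves the choice.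

    Density rests on two facts.  Every subobject in D of an object of C is
    isomorphic to one of C, as a pullback of the generic monomorphism that C
    and D share, and fullness carries coactions along the isomorphism
    ([coalg_small]).  And every f: A -> I from an object of C to a coalgebra of
    D factors through a coalgebra map F P -> I ([coalg_cover]): the site
    condition puts the composite of f with the coaction of I through some
    W h: W B -> W I with B in C, and the pullback of W h along the coaction is
    a coalgebra P over I that f factors through; it lies in C because P -> W B
    is a pullback of the split monomorphism I -> W I.  A natural family on
    coalgebra maps F P -> I therefore extends along such factorizations to a
    natural family on all maps A -> I, to which the density of i applies. *)

(** * Monomorphisms, pullbacks and least subobjects *)

Section Basics.
Variable C : Category.

Lemma eq_homK (x y : C) (e : x = y) : eq_hom (esym e) ∘ eq_hom e = idc x.
Proof. by case: y / e; rewrite comp1c. Qed.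

Lemma eq_homVK (x y : C) (e : x = y) : eq_hom e ∘ eq_hom (esym e) = idc y.
Proof. by case: y / e; rewrite comp1c. Qed.

Lemma section_mono (A B : C) (m : Hom A B) (r : Hom B A) :
  r ∘ m = idc A -> mono m.
Proof.
move=> rm X u v E.
by rewrite -(comp1c u) -rm -compcA E compcA rm comp1c.
Qed.

Lemma eq_hom_mono (x y : C) (e : x = y) : mono (eq_hom e).
Proof. exact: section_mono (eq_homK e). Qed.

Lemma mono_comp (A B X : C) (m : Hom A B) (n : Hom B X) :
  mono m -> mono n -> mono (n ∘ m).
Proof. by move=> Hm Hn Y u v; rewrite -!compcA => /Hn /Hm. Qed.

Lemma factors_comp (A B X : C) (m : Hom B X) (h : Hom A B) :
  factors_through (m ∘ h) m.
Proof. by exists h. Qed.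

Lemma factors_trans (A B D X : C) (f : Hom A X) (g : Hom B X) (h : Hom D X) :
  factors_through f g -> factors_through g h -> factors_through f h.
Proof. by case=> u <- [v <-]; exists (v ∘ u); rewrite compcA. Qed.

Lemma pullback_ext (A B X P : C) (f : Hom A X) (g : Hom B X)
    (p : Hom P A) (q : Hom P B) (Z : C) (u v : Hom Z P) :
  is_pullback f g p q -> p ∘ u = p ∘ v -> q ∘ u = q ∘ v -> u = v.
Proof.
case=> E H Ep Eq.
have [|w [_ Hw]] := H Z (p ∘ v) (q ∘ v); first by rewrite !compcA E.
by rewrite -(Hw u) // -(Hw v).
Qed.

Lemma pullback_sym (A B X P : C) (f : Hom A X) (g : Hom B X)
    (p : Hom P A) (q : Hom P B) :
  is_pullback f g p q -> is_pullback g f q p.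
Proof.
case=> E H; split=> // Z u v Euv.
have [w [[w1 w2] Hw]] := H Z v u (esym Euv).
by exists w; split=> // w' [? ?]; apply: Hw.
Qed.

Lemma pullback_mono (A B X P : C) (f : Hom A X) (g : Hom B X)
    (p : Hom P A) (q : Hom P B) :
  is_pullback f g p q -> mono g -> mono p.
Proof.
move=> H Hg Z u v E; apply: (pullback_ext H) => //; apply: Hg.
by rewrite !compcA -(proj1 H) -!compcA E.
Qed.

(** This form makes monomorphisms visible to functors preserving pullbacks. *)
Lemma mono_kernel_pair (A B : C) (m : Hom A B) :
  mono m <-> is_pullback m m (idc A) (idc A).
Proof.
split=> [Hm | [_ H] Z u v E].
- split=> // Z u v E; exists u; split=> [|w [<- _]]; rewrite !comp1c //.
  by split=> //; apply: Hm.
- by have [w [[<- <-] _]] := H Z u v E.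
Qed.

Lemma pullback_paste (A B X P A' X' : C) (f : Hom A X) (g : Hom B X)
    (p : Hom P A) (q : Hom P B) (f' : Hom X X') (g' : Hom A' X')
    (h : Hom B A') :
  is_pullback f' g' g h -> is_pullback f g p q ->
  is_pullback (f' ∘ f) g' p (h ∘ q).
Proof.
move=> [E1 H1] [E2 H2]; split.
  by rewrite -compcA E2 compcA E1 compcA.
move=> Z u v; rewrite -compcA => /H1 [w [[w1 w2] Hw]].
have [z [[z1 z2] Hz]] := H2 Z u w (esym w1).
exists z; split; first by rewrite -compcA z2.
move=> z' [z'1 z'2]; apply: Hz; split=> //.
rewrite (Hw (q ∘ z')) //; split.
- by rewrite compcA -E2 -compcA z'1.
- by rewrite compcA.
Qed.

Lemma iso_pullback (A B X P : C) (f : Hom A X) (g : Hom B X)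
    (p : Hom P A) (q : Hom P B) (r : Hom B P) :
  mono f -> r ∘ q = idc P -> q ∘ r = idc B -> f ∘ p = g ∘ q ->
  is_pullback f g p q.
Proof.
move=> Mf rq qr E; split=> // Z u v Euv; exists (r ∘ v).
split=> [|w [_ <-]]; last by rewrite compcA rq comp1c.
split; last by rewrite compcA qr comp1c.
by apply: Mf; rewrite Euv compcA E -compcA (compcA q) qr comp1c.
Qed.

(** A classifying square over t' pastes with the given square over t. *)
Lemma generic_of_pullback (U V U' V' : C) (t : Hom U V) (t' : Hom U' V')
    (f : Hom V' V) (g : Hom U' U) :
  generic_mono t' -> mono t -> is_pullback f t t' g -> generic_mono t.
Proof.
move=> [_ Gt'] Mt H; split=> // A B m Mm.
have [f0 [g0 H0]] := Gt' A B m Mm.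
by exists (f ∘ f0), (g ∘ g0); apply: pullback_paste H H0.
Qed.

(** Images, bottoms and unions are all of this form, which lets them be lifted
    to coalgebras by a single argument. *)
Definition is_least (X S : C) (Q : forall S : C, Hom S X -> Prop)
    (m : Hom S X) : Prop :=
  [/\ mono m, Q S m &
      forall (S' : C) (m' : Hom S' X), mono m' -> Q S' m' ->
        factors_through m m'].

Lemma least_ext (X : C) (Q Q' : forall S : C, Hom S X -> Prop) :
  (forall (S : C) (m : Hom S X), mono m -> Q S m <-> Q' S m) ->
  forall (S : C) (m : Hom S X), is_least Q m <-> is_least Q' m.
Proof.
move=> QQ' S m; split=> -[Mm Qm Lm]; split=> //; try exact/QQ'.
- by move=> S' m' Mm' /(QQ' _ _ Mm'); apply: Lm.
- by move=> S' m' Mm' /(QQ' _ _ Mm'); apply: Lm.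
Qed.

Lemma image_least (A B I : C) (f : Hom A B) (m : Hom I B) :
  is_image f m <-> is_least (fun S m' => factors_through f m') m.
Proof. by []. Qed.

Lemma bottom_least (X Z : C) (z : Hom Z X) :
  is_bottom z <-> is_least (fun S m => True) z.
Proof.
split=> [[Mz Lz] | [Mz _ Lz]]; split=> //.
- by move=> S m Mm _; apply: Lz.
- by move=> S m Mm; apply: Lz.
Qed.

Lemma union_least (X A B U : C) (m : Hom A X) (n : Hom B X) (u : Hom U X) :
  is_union m n u <->
  is_least (fun S v => factors_through m v /\ factors_through n v) u.
Proof.
split=> [[Mu mu nu Lu] | [Mu [mu nu] Lu]]; split=> //.
- by move=> S v Mv []; apply: Lu.
- by move=> S v Mv mv nv; apply: Lu.
Qed.

Lemma least_factors (X S R : C) (Q : forall S : C, Hom S X -> Prop)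
    (m : Hom S X) (r : Hom R X) :
  is_least Q m -> mono r -> Q R r -> factors_through r m -> is_least Q r.
Proof.
move=> [Mm Qm Lm] Mr Qr rm; split=> // S' m' Mm' Qm'.
exact: factors_trans rm (Lm _ _ Mm' Qm').
Qed.

Lemma dual_image_factors (A B S R R' : C) (f : Hom A B) (s : Hom S A)
    (r : Hom R B) (r' : Hom R' B) :
  is_dual_image f s r -> mono r' ->
  factors_through r r' -> factors_through r' r -> is_dual_image f s r'.
Proof.
move=> [Mr Hr] Mr' rr' r'r; split=> // T P t p q Mt H.
rewrite (Hr T P t p q Mt H); split=> F; exact: factors_trans F _.
Qed.

End Basics.

(** * Pullbacks and pairs as finite limits *)

Section ThinCategory.
Variables (T : Type) (r : T -> T -> bool).
Hypotheses (r_refl : forall x, r x x)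
  (r_trans : forall x y z, r y z -> r x y -> r x z).

(** Hom-types are propositions, so the category laws hold by proof
    irrelevance. *)
Definition thin : Category.
Proof.
refine {| Ob := T; Hom := fun x y => is_true (r x y); idc := r_refl;
          compc := r_trans |}; by move=> *; apply: proof_irrelevance.
Defined.

Lemma thin_irrel (x y : thin) (h h' : Hom x y) : h = h'.
Proof. exact: (proof_irrelevance (r x y) h h'). Qed.

Lemma thin_finite : finite_type T -> finite_category thin.
Proof.
move=> finT; split=> // x y /=.
case: (r x y); last by exists nil.
by exists (cons (eq_refl true) nil) => h; left; apply: proof_irrelevance.
Qed.

End ThinCategory.

Inductive cospan_ob := Lft | Rgt | Mid.

Definition cospan_le (x y : cospan_ob) : bool :=
  match x, y with
  | Lft, Lft | Rgt, Rgt | _, Mid => true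
  | _, _ => false
  end.

Lemma cospan_le_refl x : cospan_le x x.
Proof. by case: x. Qed.

Lemma cospan_le_trans x y z : cospan_le y z -> cospan_le x y -> cospan_le x z.
Proof. by case: x; case: y; case: z. Qed.

Definition cospan : Category := thin cospan_le_refl cospan_le_trans.

Lemma cospan_finite : finite_category cospan.
Proof.
by apply: thin_finite; exists (Lft :: Rgt :: Mid :: nil)%list; case=> /=; auto.
Qed.

Definition lft_mid : Hom (c := cospan) Lft Mid := eq_refl true.
Definition rgt_mid : Hom (c := cospan) Rgt Mid := eq_refl true.

Section Cospan.
Variables (C : Category) (A B X : C) (f : Hom A X) (g : Hom B X).

Definition cospan_ob_map (x : cospan) : C :=
  match x with Lft => A | Rgt => B | Mid => X end.

Definition cospan_diagram : Functor cospan C.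
Proof.
refine {| fob := cospan_ob_map;
  fmap := fun x y => match x, y
    return is_true (cospan_le x y) -> Hom (cospan_ob_map x) (cospan_ob_map y)
    with
    | Lft, Lft => fun _ => idc A
    | Rgt, Rgt => fun _ => idc B
    | Mid, Mid => fun _ => idc X
    | Lft, Mid => fun _ => f
    | Rgt, Mid => fun _ => g
    | _, _ => fun h => False_rect _ (Bool.diff_false_true h)
    end |}.
- by case.
- by case; case; case=> //= *; rewrite ?comp1c ?compc1.
Defined.

Definition cospan_cone (P : C) (p : Hom P A) (q : Hom P B)
  (E : f ∘ p = g ∘ q) : Cone cospan_diagram.
Proof.
refine {| apex := P : C; leg := fun x : cospan => match x as x
    return Hom P (cospan_diagram x) with
    | Lft => p | Rgt => q | Mid => f ∘ p end |}.
by case; case=> //= _; rewrite comp1c.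
Defined.

End Cospan.

(** Stated for an arbitrary diagram on the cospan so that it also applies to the
    composite of such a diagram with a functor. *)
Lemma cospan_limit (C : Category) (T : Functor cospan C) (c : Cone T) :
  is_limit c <->
  is_pullback (fmap T lft_mid) (fmap T rgt_mid) (leg c Lft) (leg c Rgt).
Proof.
split=> [Hc | [E H] d].
- split; first by rewrite !leg_nat.
  move=> Z u v Euv.
  have N (x y : cospan) (h : Hom x y) :
    fmap T h ∘ (match x return Hom Z (T x) with
                | Lft => u | Rgt => v | Mid => fmap T lft_mid ∘ u end)
    = match y return Hom Z (T y) with
      | Lft => u | Rgt => v | Mid => fmap T lft_mid ∘ u end.
    case: x y h; case=> // h.
    + by rewrite (thin_irrel h (idc (c := cospan) Lft)) fmap1 comp1c.
    + by rewrite (thin_irrel h lft_mid).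
    + by rewrite (thin_irrel h (idc (c := cospan) Rgt)) fmap1 comp1c.
    + by rewrite Euv (thin_irrel h rgt_mid).
    + by rewrite (thin_irrel h (idc (c := cospan) Mid)) fmap1 comp1c.
  have [w [Hw Uw]] := Hc {| apex := Z; leg_nat := N |}.
  exists w; split; first by split; [apply: (Hw Lft) | apply: (Hw Rgt)].
  move=> w' [w'l w'r]; apply: Uw; case=> //=.
  by rewrite -(leg_nat c lft_mid) -compcA w'l.
- have [|w [[wl wr] Uw]] := H (apex d) (leg d Lft) (leg d Rgt).
    by rewrite !leg_nat.
  exists w; split.
    by case=> //; rewrite -(leg_nat c lft_mid) -compcA wl leg_nat.
  by move=> w' Hw'; apply: Uw; rewrite !Hw'.
Qed.

Lemma pullback_exists (C : CartesianCategory) (A B X : C) (f : Hom A X)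
    (g : Hom B X) :
  exists (P : C) (p : Hom P A) (q : Hom P B), is_pullback f g p q.
Proof.
have /cospan_limit H := lim_is_limit cospan_finite (cospan_diagram f g).
by eexists _, _, _; exact: H.
Qed.

Lemma cartesian_pullback (C D : Category) (F : Functor C D) :
  cartesian_functor F ->
  forall (A B X P : C) (f : Hom A X) (g : Hom B X) (p : Hom P A) (q : Hom P B),
  is_pullback f g p q ->
  is_pullback (fmap F f) (fmap F g) (fmap F p) (fmap F q).
Proof.
move=> HF A B X P f g p q H.
have Hc : is_limit (cospan_cone (proj1 H)) by apply/cospan_limit.
by have /cospan_limit := HF _ cospan_finite _ _ Hc.
Qed.

Lemma cartesian_mono (C D : Category) (F : Functor C D) :
  cartesian_functor F ->
  forall (A B : C) (m : Hom A B), mono m -> mono (fmap F m).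
Proof.
move=> HF A B m /mono_kernel_pair /(cartesian_pullback HF).
by rewrite !fmap1 => /mono_kernel_pair.
Qed.

Lemma eqb_trans x y z : Bool.eqb y z -> Bool.eqb x y -> Bool.eqb x z.
Proof. by case: x; case: y; case: z. Qed.

Definition pair_cat : Category := thin Bool.eqb_reflx eqb_trans.

Lemma pair_cat_finite : finite_category pair_cat.
Proof.
by apply: thin_finite; exists (true :: false :: nil)%list; case=> /=; auto.
Qed.

Definition pair_diagram (C : Category) (A B : C) : Functor pair_cat C.
Proof.
refine {| fob := fun x : pair_cat => if x then A else B;
  fmap := fun x y => match x, y
    return is_true (Bool.eqb x y) ->
           Hom (if x then A else B) (if y then A else B) with
    | true, true => fun _ => idc A
    | false, false => fun _ => idc B
    | _, _ => fun h => False_rect _ (Bool.diff_false_true h)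
    end |}.
- by case.
- by case; case; case=> //= *; rewrite ?comp1c.
Defined.

(** Only the existence half of the universal property of a product is recorded:
    it turns a jointly monic pair into one monomorphism. *)
Lemma pair_limit (C : Category) (T : Functor pair_cat C) (c : Cone T) (Z : C)
    (u : Hom Z (T true)) (v : Hom Z (T false)) :
  is_limit c ->
  exists h : Hom Z c, leg c true ∘ h = u /\ leg c false ∘ h = v.
Proof.
move=> Hc.
have N (x y : pair_cat) (h : Hom x y) :
  fmap T h ∘ (if x return Hom Z (T x) then u else v)
  = if y return Hom Z (T y) then u else v.
  case: x y h; case=> // h.
  - by rewrite (thin_irrel h (idc (c := pair_cat) true)) fmap1 comp1c.
  - by rewrite (thin_irrel h (idc (c := pair_cat) false)) fmap1 comp1c.
have [w [Hw _]] := Hc {| apex := Z; leg_nat := N |}.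
by exists w; split; [apply: (Hw true) | apply: (Hw false)].
Qed.

(** Any limit cone is isomorphic to the chosen one, whose image is a limit. *)
Lemma strict_cartesian (C D : CartesianCategory) (F : Functor C D) :
  strictly_preserves_lim F -> cartesian_functor F.
Proof.
move=> HF J finJ T c Hc d.
have [e He] := HF J finJ T.
have [k [Hk _]] := Hc (lim finJ T).
have [h [Hh _]] := lim_is_limit finJ T c.
have [u [Hu Uu]] := lim_is_limit finJ (comp_functor F T) d.
have E j : leg (lim finJ (comp_functor F T)) j ∘ eq_hom e ∘ fmap F h
           = fmap F (leg c j) by rewrite He -fmapM Hh.
have hk : k ∘ h = idc (apex c).
  by apply: (limit_ext Hc) => j; rewrite compcA Hk Hh compc1.
exists (fmap F k ∘ eq_hom (esym e) ∘ u); split.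
- move=> j; rewrite /= !compcA -fmapM Hk -He -(compcA _ (eq_hom e)).
  by rewrite eq_homVK compc1 Hu.
- move=> v Hv.
  have -> : u = eq_hom e ∘ fmap F h ∘ v.
    by apply: Uu => j; rewrite !compcA E -(Hv j).
  rewrite !compcA -(compcA _ (eq_hom (esym e))) eq_homK compc1 -fmapM hk.
  by rewrite fmap1 comp1c.
Qed.

(** * Coalgebras for a Cartesian comonad *)

Section Coalgebras.
Variables (C : CartesianCategory) (W : CartesianComonad C).

(** The chosen limits of coalgebras are by construction those of carriers. *)
Lemma forget_cartesian : cartesian_functor (forget W).
Proof.
apply: (@strict_cartesian (CartCoalg W)) => J finJ T.
by exists eq_refl => j /=; rewrite compc1.
Qed.

Lemma W_mono (A B : C) (m : Hom A B) : mono m -> mono (fmap W m).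
Proof. exact/cartesian_mono/cart_comonad_cartesian. Qed.

Lemma W_pullback (A B X P : C) (f : Hom A X) (g : Hom B X) (p : Hom P A)
    (q : Hom P B) :
  is_pullback f g p q ->
  is_pullback (fmap W f) (fmap W g) (fmap W p) (fmap W q).
Proof. exact/cartesian_pullback/cart_comonad_cartesian. Qed.

Lemma coact_mono (A : Coalg W) : mono (coact A).
Proof. exact: section_mono (coact_counit A). Qed.

Lemma coalg_mono (A B : Coalg W) (m : Hom A B) :
  mono m <-> mono (coalg_arr m).
Proof.
split=> [/(cartesian_mono forget_cartesian) // | Hm X u v E].
apply: coalg_hom_eq; apply: Hm.
exact: (f_equal (@coalg_arr _ _ _ _) E).
Qed.

(** The mediating map on carriers is a homomorphism because W preserves the
    pullback, whose projections can therefore be used to test the equation. *)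
Lemma coalg_pullback (A B X P : Coalg W) (f : Hom A X) (g : Hom B X)
    (p : Hom P A) (q : Hom P B) :
  is_pullback f g p q <->
  is_pullback (coalg_arr f) (coalg_arr g) (coalg_arr p) (coalg_arr q).
Proof.
split=> [/(cartesian_pullback forget_cartesian) // | [E H]].
split=> [|Z u v Euv]; first exact: coalg_hom_eq.
have [w [[pw qw] Uw]] := H Z _ _ (f_equal (@coalg_arr _ _ _ _) Euv).
have wP : fmap W w ∘ coact Z = coact P ∘ w.
  apply: (pullback_ext (W_pullback (conj E H))); rewrite !compcA -fmapM.
  - by rewrite pw !coalg_arrP -compcA pw.
  - by rewrite qw !coalg_arrP -compcA qw.
exists {| coalg_arr := w; coalg_arrP := wP |}; split.
  by split; apply: coalg_hom_eq.
move=> w' [E1 E2]; apply: coalg_hom_eq; apply: Uw; split.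
- exact: (f_equal (@coalg_arr _ _ _ _) E1).
- exact: (f_equal (@coalg_arr _ _ _ _) E2).
Qed.

(** W m is a monomorphism, which makes any factorization through m on carriers
    a homomorphism. *)
Lemma coalg_factors (A B X : Coalg W) (f : Hom A X) (m : Hom B X) :
  mono m ->
  factors_through f m <-> factors_through (coalg_arr f) (coalg_arr m).
Proof.
move=> Mm; split=> [[h <-] | [h E]]; first exact: factors_comp.
have hP : fmap W h ∘ coact A = coact B ∘ h.
  apply: (W_mono (proj1 (coalg_mono m) Mm)).
  by rewrite !compcA -fmapM E !coalg_arrP -compcA E.
by exists {| coalg_arr := h; coalg_arrP := hP |}; apply: coalg_hom_eq.
Qed.

Definition cofree (A : C) : Coalg W :=
  {| carrier := W A; coact := comult W A; coact_counit := counit_comult W A;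
     coact_comult := comult_comult W A |}.

Definition cofree_hom (A B : C) (f : Hom A B) : Hom (cofree A) (cofree B) :=
  {| coalg_arr := fmap W f : Hom (carrier (cofree A)) (carrier (cofree B));
     coalg_arrP := esym (comult_nat W f) |}.

Definition coact_hom (A : Coalg W) : Hom A (cofree A) :=
  {| coalg_arr := coact A : Hom (carrier A) (carrier (cofree A));
     coalg_arrP := esym (coact_comult A) |}.

(** The interior b^*(W m) is a pullback of coalgebras: both the coaction of B
    and W m are homomorphisms into the cofree coalgebra. *)
Lemma interior_exists (B : Coalg W) (S : C) (m : Hom S B) :
  exists (P : Coalg W) (p : Hom P B) (q : Hom P (cofree S)),
    is_pullback (coact_hom B) (cofree_hom m) p q.
Proof. exact: (@pullback_exists (CartCoalg W)). Qed.

(** The counit retracts the coaction, so it takes the second projection of the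
    interior to a factorization through m. *)
Lemma interior_factors (B : Coalg W) (S P : C) (m : Hom S B) (p : Hom P B)
    (q : Hom P (W S)) :
  is_pullback (coact B) (fmap W m) p q -> factors_through p m.
Proof.
move=> [E _]; exists (counit W S ∘ q).
by rewrite compcA -counit_nat -compcA -E compcA coact_counit comp1c.
Qed.

(** If f = m h then b f = W f a = W m (W h a), where a is the coaction of A. *)
Lemma interior_universal (A B : Coalg W) (f : Hom A B) (S P : C) (m : Hom S B)
    (p : Hom P B) (q : Hom P (W S)) :
  is_pullback (coact B) (fmap W m) p q ->
  factors_through (coalg_arr f) m -> factors_through (coalg_arr f) p.
Proof.
move=> [_ H] [h E].
have [|w [[pw _] _]] := H A (coalg_arr f) (fmap W h ∘ coact A).
  by rewrite compcA -fmapM E coalg_arrP.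
by exists w.
Qed.

Section Least.
Variables (B : Coalg W) (Q : forall S : C, Hom S B -> Prop).
Hypothesis Q_interior :
  forall (S P : C) (m : Hom S B) (p : Hom P B) (q : Hom P (W S)),
    is_pullback (coact B) (fmap W m) p q -> Q m -> Q p.

Let QW (S : Coalg W) (m : Hom S B) : Prop := Q (coalg_arr m).

Lemma least_lift (M : Coalg W) (m : Hom M B) :
  is_least Q (coalg_arr m) -> is_least QW m.
Proof.
move=> [Mm Qm Lm]; split=> //; first exact/coalg_mono.
move=> S m' Mm' Qm'; apply/coalg_factors => //.
by apply: Lm => //; apply/coalg_mono.
Qed.

(** The interior of the least subobject again satisfies Q and is contained in
    it, so it is least as well; and it is a subcoalgebra. *)
Lemma least_exists (S : C) (m : Hom S B) :
  is_least Q m -> exists M : Sub B, is_least Q (coalg_arr (sub_arr M)).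
Proof.
move=> Lm; have [Mm Qm _] := Lm.
have [P [p [q /coalg_pullback /= H]]] := interior_exists m.
have Mp := pullback_mono H (W_mono Mm).
have Mp' : mono p by exact/coalg_mono.
exists {| sub_mono := Mp' |} => /=.
apply: (least_factors Lm) => //; first exact: Q_interior H Qm.
exact: interior_factors H.
Qed.

(** From left to right, n is compared with the least subcoalgebra provided by
    [least_exists], which is least on carriers too. *)
Lemma least_iff (S : C) (m : Hom S B) :
  is_least Q m ->
  forall (M : Coalg W) (n : Hom M B),
    is_least QW n <-> is_least Q (coalg_arr n).
Proof.
move=> Lm M n; split=> [[Mn Qn Ln] | ]; last exact: least_lift.
have [[R r Mr] /= Lr] := least_exists Lm.
apply: (least_factors Lr) => //; first exact/coalg_mono.
by apply/coalg_factors => //; apply: Ln => //; have [] := Lr.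
Qed.

End Least.

Hypothesis heytC : heyting_category C.
Let cohC := heyting_coherent heytC.

Lemma coalg_image_exists (A B : Coalg W) (f : Hom A B) :
  exists M : Sub B, is_image (coalg_arr f) (coalg_arr (sub_arr M)).
Proof.
have [M0 L0] := coh_image cohC (coalg_arr f).
exact: least_exists (@interior_universal A B f) _ _ L0.
Qed.

Lemma coalg_image (A B I : Coalg W) (f : Hom A B) (m : Hom I B) :
  is_image f m <-> is_image (coalg_arr f) (coalg_arr m).
Proof.
have [M0 L0] := coh_image cohC (coalg_arr f).
rewrite !image_least -(least_iff (@interior_universal A B f) L0).
by apply: least_ext => S n Mn; apply: coalg_factors.
Qed.

Lemma coalg_bottom_exists (X : Coalg W) :
  exists M : Sub X, is_bottom (coalg_arr (sub_arr M)).
Proof.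
have [M0 /bottom_least L0] := coh_bottom cohC (X : C).
have [//|M LM] := least_exists _ L0.
by exists M; apply/bottom_least.
Qed.

Lemma coalg_bottom (X Z : Coalg W) (z : Hom Z X) :
  is_bottom z <-> is_bottom (coalg_arr z).
Proof.
have [M0 /bottom_least L0] := coh_bottom cohC (X : C).
by rewrite !bottom_least -(least_iff _ L0).
Qed.

Lemma union_interior (X A B : Coalg W) (a : Hom A X) (b : Hom B X)
    (S P : C) (m : Hom S X) (p : Hom P X) (q : Hom P (W S)) :
  is_pullback (coact X) (fmap W m) p q ->
  factors_through (coalg_arr a) m /\ factors_through (coalg_arr b) m ->
  factors_through (coalg_arr a) p /\ factors_through (coalg_arr b) p.
Proof. by move=> H []; split; apply: interior_universal H _. Qed.

Lemma underlying_union (X A B : Coalg W) (a : Hom A X) (b : Hom B X) :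
  mono a -> mono b ->
  exists M : Sub (X : C), is_union (coalg_arr a) (coalg_arr b) M.
Proof.
move=> /coalg_mono Ma /coalg_mono Mb.
exact: (coh_union cohC {| sub_mono := Ma |} {| sub_mono := Mb |}).
Qed.

Lemma coalg_union_exists (X A B : Coalg W) (a : Hom A X) (b : Hom B X) :
  mono a -> mono b ->
  exists M : Sub X,
    is_union (coalg_arr a) (coalg_arr b) (coalg_arr (sub_arr M)).
Proof.
move=> Ma Mb; have [M0 /union_least L0] := underlying_union Ma Mb.
have [M LM] := least_exists (@union_interior X A B a b) L0.
by exists M; apply/union_least.
Qed.

Lemma coalg_union (X A B U : Coalg W) (a : Hom A X) (b : Hom B X)
    (u : Hom U X) :
  mono a -> mono b ->
  is_union a b u <-> is_union (coalg_arr a) (coalg_arr b) (coalg_arr u).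
Proof.
move=> Ma Mb; have [M0 /union_least L0] := underlying_union Ma Mb.
rewrite !union_least -(least_iff (@union_interior X A B a b) L0).
by apply: least_ext => S n Mn; rewrite !coalg_factors.
Qed.

Lemma coalg_coherent : coherent_category (CartCoalg W).
Proof.
split.
- move=> A B f; have [M HM] := coalg_image_exists f.
  by exists M; apply/coalg_image.
- move=> A B I B' A' I' f m g f' a m' b /coalg_image H /coalg_pullback H1
    /coalg_pullback H2; apply/coalg_image.
  exact: (coh_image_stable cohC) H H1 H2.
- move=> X; have [M HM] := coalg_bottom_exists X.
  by exists M; apply/coalg_bottom.
- move=> X X' Z Z' z g z' q /coalg_bottom H /coalg_pullback H1.
  by apply/coalg_bottom; apply: (coh_bottom_stable cohC) H H1.
- move=> X [A m Mm] [B n Mn]; have [M HM] := coalg_union_exists Mm Mn.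
  by exists M; apply/coalg_union.
- move=> X X' A B U A' B' U' g m n u m' n' u' a b c Mm Mn Hu H1 H2 H3.
  apply/coalg_union; try exact: (pullback_mono H1 Mm);
    try exact: (pullback_mono H2 Mn).
  move: H1 H2 H3 Hu => /coalg_pullback H1 /coalg_pullback H2 /coalg_pullback H3.
  move=> /(coalg_union _ Mm Mn) Hu.
  by apply: (coh_union_stable cohC) Hu H1 H2 H3; apply/coalg_mono.
Qed.

(** A subcoalgebra is contained in r0 exactly when it is contained in the
    interior of r0. *)
Lemma coalg_dual_image (A B S R : Coalg W) (R0 : C) (f : Hom A B)
    (s : Hom S A) (r0 : Hom R0 B) (r : Hom R B)
    (q : Hom (carrier R) (W R0)) :
  mono s -> is_dual_image (coalg_arr f) (coalg_arr s) r0 ->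
  is_pullback (coact B) (fmap W r0) (coalg_arr r) q ->
  is_dual_image f s r.
Proof.
move=> Ms [Mr0 H0] H.
have Mr : mono r by apply/coalg_mono; exact: pullback_mono H (W_mono Mr0).
split=> // T P t p p' Mt Hp.
rewrite (coalg_factors _ Ms) (coalg_factors _ Mr).
move/coalg_mono: Mt => Mt; move/coalg_pullback: Hp => Hp.
rewrite (H0 _ _ _ _ _ Mt Hp); split; first exact: interior_universal H.
by move/factors_trans; apply; exact: interior_factors H.
Qed.

Lemma coalg_dual_image_exists (A B S : Coalg W) (f : Hom A B) (s : Hom S A) :
  mono s ->
  exists (R0 : C) (r0 : Hom R0 B) (R : Coalg W) (r : Hom R B)
    (q : Hom R (cofree R0)),
  [/\ is_dual_image (coalg_arr f) (coalg_arr s) r0,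
      is_pullback (coact_hom B) (cofree_hom r0) r q &
      is_dual_image f s r].
Proof.
move=> Ms; have Ms' := proj1 (coalg_mono s) Ms.
have [F /(_ {| sub_mono := Ms' |}) /= HF] :=
  heyting_right_adjoint heytC (coalg_arr f).
have [R [r [q H]]] := interior_exists (F {| sub_mono := Ms' |}).
exists _, (F {| sub_mono := Ms' |}), R, r, q; split=> //.
by move/coalg_pullback: H; apply: coalg_dual_image.
Qed.

Lemma coalg_heyting : heyting_category (CartCoalg W).
Proof.
split; first exact: coalg_coherent.
move=> A B f.
have H (S : Sub A) : exists R : Sub B, is_dual_image f S R.
  have [R0 [r0 [R [r [q [_ _ Hr]]]]]] :=
    coalg_dual_image_exists f (@sub_mono _ _ S).
  by exists {| sub_mono := proj1 Hr |}.
exists (fun S => proj1_sig (constructive_indefinite_description _ (H S))) => S.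
by case: constructive_indefinite_description.
Qed.

End Coalgebras.

(** * The cofree generic monomorphism *)

Section Generic.
Variables (C : CartesianCategory) (W : CartesianComonad C).

(** A subcoalgebra is its own interior. *)
Lemma coalg_mono_pullback (A B : Coalg W) (m : Hom A B) :
  mono m ->
  is_pullback (coact B) (fmap W (coalg_arr m)) (coalg_arr m) (coact A).
Proof.
move=> /coalg_mono Mm; split=> [|Z u v E]; first by rewrite coalg_arrP.
have Eu : coalg_arr m ∘ (counit W A ∘ v) = u.
  rewrite compcA -counit_nat -compcA -E compcA coact_counit.
  exact: comp1c.
exists (counit W A ∘ v); split=> [|w [Ew _]]; last first.
  by apply: Mm; rewrite Eu Ew.
split=> //; apply: (W_mono Mm).
by rewrite compcA coalg_arrP -compcA Eu E.
Qed.

(** If x classifies the underlying subobject of m: A -> B, then W x composed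
    with the coaction of B classifies m. *)
Lemma cofree_generic (U V : C) (t : Hom U V) :
  generic_mono t -> generic_mono (cofree_hom W t).
Proof.
move=> [Mt Gt]; split; first by apply/coalg_mono; exact: W_mono.
move=> A B m Mm.
have [|f [g H]] := Gt _ _ (coalg_arr m); first exact/coalg_mono.
exists (cofree_hom W f ∘ coact_hom B), (cofree_hom W g ∘ coact_hom A).
apply/coalg_pullback.
exact: pullback_paste (W_pullback W H) (coalg_mono_pullback Mm).
Qed.

Lemma coalg_has_generic : has_generic_mono C -> has_generic_mono (CartCoalg W).
Proof.
by move=> [U [V [t /cofree_generic Gt]]]; exists _, _, (cofree_hom W t).
Qed.

End Generic.

(** * Density of functors *)

Lemma homnat_ext (C D : Category) (G : Functor C D) (I X : D)
    (a b : HomNat G I X) :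
  (forall (A : C) (f : Hom (G A) I), a A f = b A f) -> a = b.
Proof.
case: a b => [a Ha] [b Hb] /= E.
have {}E : a = b.
  apply: functional_extensionality_dep => A.
  by apply: functional_extensionality_dep => f; apply: E.
by subst b; rewrite (proof_irrelevance _ Ha Hb).
Qed.

(** The injectivity half of density. *)
Lemma dense_ext (C D : Category) (G : Functor C D) (I X : D) (g g' : Hom I X) :
  dense_functor G ->
  (forall (A : C) (f : Hom (G A) I), g ∘ f = g' ∘ f) -> g = g'.
Proof.
move=> denseG E; have [r rK _] := denseG I X.
by rewrite -(rK g) -(rK g'); congr r; apply: homnat_ext.
Qed.

(** * Strict preservation of limits by the inclusion *)

(** The conclusion also identifies the transport along the equality, which the
    strict preservation of limits needs on the legs. *)
Lemma coalg_ob_eq (C : Category) (W : Comonad C) (A B : Coalg W)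
    (e : carrier A = carrier B) :
  fmap W (eq_hom e) ∘ coact A = coact B ∘ eq_hom e ->
  exists E : A = B, coalg_arr (eq_hom E) = eq_hom e.
Proof.
case: A B e => [A a a1 a2] [B b b1 b2] /= e; subst B => /=.
rewrite fmap1 comp1c compc1 => E; subst b.
rewrite (proof_irrelevance _ b1 a1) (proof_irrelevance _ b2 a2).
by exists eq_refl.
Qed.

Section Inclusion.
Variables (C D : CartesianCategory).
Variables (BoxC : CartesianComonad C) (BoxD : CartesianComonad D).
Variable i : ComonadInclusion BoxC BoxD.

Let Hs : strict_comonad_morphism BoxC BoxD i := cincl_strict i.
Let F : Functor (CartCoalg BoxC) (CartCoalg BoxD) := coalg_inclusion i.

Lemma incl_faithful (A B : C) (f g : Hom A B) : fmap i f = fmap i g -> f = g.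
Proof.
by have [h hK _] := incl_full_faithful (cincl_full i) A B => /(f_equal h);
  rewrite !hK.
Qed.

Lemma incl_surj (A B : C) (f : Hom (i A) (i B)) : exists g, fmap i g = f.
Proof.
by have [h _ hK] := incl_full_faithful (cincl_full i) A B; exists (h f).
Qed.

(** Transports along equalities of objects are isomorphisms and i is faithful,
    so both cancel. *)
Lemma incl_coalg_reflect (A B : Coalg BoxC) (g : Hom (carrier A) (carrier B)) :
  fmap BoxD (fmap i g) ∘ incl_coact Hs A = incl_coact Hs B ∘ fmap i g ->
  fmap BoxC g ∘ coact A = coact B ∘ g.
Proof.
rewrite /incl_coact compcA scm_map -!compcA => /eq_hom_mono.
by rewrite -!fmapM => /incl_faithful.
Qed.

Lemma eq_hom_incl (A B : C) (e : A = B) (e' : i A = i B) :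
  eq_hom e' = fmap i (eq_hom e).
Proof.
case: B / e e' => e'; rewrite (proof_irrelevance _ e' eq_refl) /=.
by rewrite fmap1.
Qed.

Lemma coalg_incl_inj : injective (fob F).
Proof.
move=> A B E.
have [e He] : exists e : i (carrier A) = i (carrier B),
    fmap BoxD (eq_hom e) ∘ incl_coact Hs A = incl_coact Hs B ∘ eq_hom e.
  change (exists e : carrier (F A) = carrier (F B),
    fmap BoxD (eq_hom e) ∘ coact (F A) = coact (F B) ∘ eq_hom e).
  case: (F B) / E; exists eq_refl.
  by rewrite /= fmap1 comp1c compc1.
have eAB := incl_inj (cincl_full i) e.
have [|//] := @coalg_ob_eq C BoxC A B eAB.
by apply: incl_coalg_reflect; rewrite -(eq_hom_incl eAB e).
Qed.

Lemma coalg_incl_full_faithful (A B : Coalg BoxC) : bijective (@fmap _ _ F A B).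
Proof.
have [h hK Kh] := incl_full_faithful (cincl_full i) (carrier A) (carrier B).
have HP (f : Hom (F A) (F B)) :
    fmap BoxC (h (coalg_arr f)) ∘ coact A = coact B ∘ h (coalg_arr f).
  by apply: incl_coalg_reflect; rewrite Kh; exact: (coalg_arrP f).
exists (fun f => {| coalg_arrP := HP f |} : @Hom (Coalg BoxC) A B) => f;
  apply: coalg_hom_eq; [exact: hK | exact: Kh].
Qed.

(** Carriers and legs come from the strict preservation by i; the two coactions
    on the common carrier agree because each makes the legs homomorphisms. *)
Lemma coalg_incl_lim : strictly_preserves_lim F.
Proof.
move=> J finJ T.
pose UT := comp_functor (forget BoxC) T.
have [e He] : exists e : i (lim finJ UT)
      = lim finJ (comp_functor (forget BoxD) (comp_functor F T)),
    forall j, leg (lim finJ (comp_functor (forget BoxD) (comp_functor F T))) j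
      ∘ eq_hom e = fmap i (leg (lim finJ UT) j).
  (* The two underlying diagrams differ only in their proofs of functoriality. *)
  have := incl_lim (cincl_full i) finJ UT.
  rewrite /comp_functor /=.
  set p := comp_fmap1 _ _; set q := comp_fmapM _ _ => H.
  set p' := comp_fmap1 _ _; set q' := comp_fmapM _ _.
  by rewrite (proof_irrelevance _ p' p) (proof_irrelevance _ q' q).
have [|E HE] := @coalg_ob_eq D BoxD (F (lim finJ T))
    (lim finJ (comp_functor F T)) e.
  pose L := lim finJ (comp_functor (forget BoxD) (comp_functor F T)).
  apply: (limit_ext (c := map_cone BoxD L)) => [|j].
    exact: cart_comonad_cartesian (lim_is_limit finJ _).
  change (
    fmap BoxD (leg L j) ∘ (fmap BoxD (eq_hom e) ∘ coact (F (lim finJ T)))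
    = fmap BoxD (leg L j) ∘ (lim_coact finJ (comp_functor F T) ∘ eq_hom e)).
  have legP : fmap BoxD (leg L j) ∘ lim_coact finJ (comp_functor F T)
      = coact (F (T j)) ∘ leg L j := lim_coactP finJ (comp_functor F T) j.
  rewrite [LHS]compcA -fmapM He [RHS]compcA legP -[RHS]compcA He.
  exact: (coalg_arrP (fmap F (leg (lim finJ T) j))).
exists E => j; apply: coalg_hom_eq.
by rewrite /= HE He.
Qed.

Lemma coalg_incl_full : cartesian_full_inclusion F.
Proof.
split; [exact: coalg_incl_inj | exact: coalg_incl_full_faithful |
        exact: coalg_incl_lim].
Qed.

Lemma coalg_incl_cartesian : cartesian_functor F.
Proof. exact: strict_cartesian coalg_incl_lim. Qed.

(** * Density of the inclusion of coalgebras *)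

Hypothesis logicalI : logical_inclusion i.
Let heytI := logical_heyting logicalI.

Lemma small_prod (A B : C) (S : D) (u : Hom S (i A)) (v : Hom S (i B)) :
  exists (Q : C) (h : Hom S (i Q)) (p : Hom Q A) (q : Hom Q B),
    fmap i p ∘ h = u /\ fmap i q ∘ h = v.
Proof.
have L := lim_is_limit pair_cat_finite (pair_diagram A B).
set c := lim _ _ in L.
have Li := heyting_cartesian heytI pair_cat_finite L.
have [h [hu hv]] := @pair_limit _ _ (map_cone i c) S u v Li.
by exists c, h, (leg c true), (leg c false).
Qed.

Section Density.
Hypothesis genC : has_generic_mono C.

(** m is a pullback of the image of the generic monomorphism of C along a map
    which by fullness comes from C, where the pullback can be formed. *)
Lemma small_mono (S : D) (A : C) (m : Hom S (i A)) :
  mono m ->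
  exists (S' : C) (h : Hom (i S') S) (k : Hom S (i S')),
    h ∘ k = idc S /\ k ∘ h = idc (i S').
Proof.
move=> Mm; have [U [V [t Gt]]] := genC.
have [_ /(_ _ _ m Mm)] := logical_generic logicalI Gt.
move=> [f [g H]]; have [f' Ef] := incl_surj f; subst f.
have [S' [p [q /(cartesian_pullback (heyting_cartesian heytI)) H']]] :=
  pullback_exists f' t.
have [h [[mh gh] _]] := proj2 H _ _ _ (proj1 H').
have [k [[pk qk] _]] := proj2 H' _ _ _ (proj1 H).
exists S', h, k; split.
- by apply: (pullback_ext H); rewrite compcA ?mh ?gh ?pk ?qk compc1.
- by apply: (pullback_ext H'); rewrite compcA ?pk ?qk ?mh ?gh compc1.
Qed.

(** The coaction of P is transported along the isomorphism of its carrier with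
    an object S of C, and comes from C by fullness.  Its axioms hold in C because
    i is faithful. *)
Lemma coalg_small (P : Coalg BoxD) (A : C) (m : Hom (carrier P) (i A)) :
  mono m ->
  exists (P' : Coalg BoxC) (h : Hom (F P') P) (k : Hom P (F P')),
    h ∘ k = idc P /\ k ∘ h = idc (F P').
Proof.
move=> /small_mono [S [h [k [hk kh]]]].
have [a Ea] := incl_surj
  (eq_hom (esym (scm_ob Hs S)) ∘ (fmap BoxD k ∘ coact P ∘ h)).
have {}Ea : eq_hom (scm_ob Hs S) ∘ fmap i a = fmap BoxD k ∘ coact P ∘ h.
  by rewrite Ea compcA eq_homVK comp1c.
have a1 : counit BoxC S ∘ a = idc S.
  apply: incl_faithful; rewrite fmapM fmap1 -(scm_counit Hs) -compcA Ea.
  by rewrite !compcA counit_nat -(compcA k) coact_counit compc1.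
have a2 : comult BoxC S ∘ a = fmap BoxC a ∘ a.
  apply: incl_faithful; rewrite !fmapM.
  apply: (@eq_hom_mono _ _ _ (scm_ob Hs (BoxC S))).
  apply: (W_mono (@eq_hom_mono _ _ _ (scm_ob Hs S))).
  rewrite !compcA -(scm_comult Hs) -(compcA _ (fmap _ _)).
  rewrite -(compcA _ (eq_hom _) (fmap i a)) Ea.
  rewrite -!compcA (compcA (eq_hom (scm_ob Hs (BoxC S)))) -(scm_map Hs).
  rewrite -(compcA _ (eq_hom _)) Ea (compcA (fmap BoxD (eq_hom _))) -fmapM Ea.
  rewrite !fmapM -!compcA (compcA (comult _ _)) comult_nat -!compcA.
  rewrite (compcA (comult _ _)) coact_comult (compcA (fmap BoxD h)) -fmapM hk.
  by rewrite fmap1 comp1c -!compcA.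
pose P' : Coalg BoxC := {| coact_counit := a1; coact_comult := a2 |}.
have hP : fmap BoxD h ∘ coact (F P') = coact P ∘ h.
  by rewrite /= /incl_coact Ea !compcA -fmapM hk fmap1 comp1c.
have kP : fmap BoxD k ∘ coact P = coact (F P') ∘ k.
  by rewrite /= /incl_coact Ea -!compcA hk compc1.
exists P', (@Build_CoalgHom D BoxD (F P') P h hP),
  (@Build_CoalgHom D BoxD P (F P') k kP).
by split; apply: coalg_hom_eq.
Qed.

Hypothesis denseI : dense_comonad_inclusion i.

(** P is the interior of h, taken for an h: i B -> I given by the site condition.
    As h need not be monic P is not a subobject of I, but it is one of W (i B),
    the coaction of I being monic. *)
Lemma coalg_cover (I : Coalg BoxD) (A : C) (f : Hom (i A) (carrier I)) :
  exists (P : Coalg BoxC) (p : Hom (F P) I) (k : Hom (i A) (i (carrier P))),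
    coalg_arr p ∘ k = f.
Proof.
have [B [h [u Eu]]] := proj2 (proj2 denseI) _ _ (coact I ∘ f).
have [P [p [q /coalg_pullback /= H]]] := interior_exists h.
have Mq : mono (coalg_arr q).
  exact: pullback_mono (pullback_sym H) (@coact_mono _ _ I).
have [P' [p' [k [pk kp]]]] :=
  coalg_small (mono_comp Mq (@eq_hom_mono _ _ _ (esym (scm_ob Hs B)))).
have [l [[pl _] _]] := proj2 H _ _ _ (esym Eu).
have pkU : coalg_arr p' ∘ coalg_arr k = idc (carrier P).
  exact: (f_equal (@coalg_arr _ _ _ _) pk).
exists P', (p ∘ p'), (coalg_arr k ∘ l).
by rewrite /= -compcA (compcA (coalg_arr p')) pkU comp1c.
Qed.

Section Extend.
Variables (I X : Coalg BoxD) (phi : HomNat F I X).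

(** The pullback Q of p and p' in coalgebras is a subobject of a product of
    objects of C, hence a coalgebra in the image of F, and on it naturality of phi
    applies.  The maps k and k' factor through Q. *)
Lemma family_compat (A : C) (P P' : Coalg BoxC) (p : Hom (F P) I)
    (p' : Hom (F P') I) (k : Hom (i A) (i (carrier P)))
    (k' : Hom (i A) (i (carrier P'))) :
  coalg_arr p ∘ k = coalg_arr p' ∘ k' ->
  coalg_arr (phi P p) ∘ k = coalg_arr (phi P' p') ∘ k'.
Proof.
move=> E.
have [Q [q [q' H]]] := @pullback_exists (CartCoalg BoxD) _ _ _ p p'.
have /coalg_pullback HU := H.
have [B [m [b [b' [Eb Eb']]]]] := small_prod (coalg_arr q) (coalg_arr q').
have Mm : mono m.
  move=> Z u v Euv; apply: (pullback_ext HU).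
  - by rewrite -Eb -!compcA Euv.
  - by rewrite -Eb' -!compcA Euv.
have [Q' [h [l [hl lh]]]] := coalg_small Mm.
have [w [[qw qw'] _]] := proj2 HU _ _ _ E.
have [r Er] : exists r : Hom Q' P, fmap F r = q ∘ h.
  by have [r _ Kr] := coalg_incl_full_faithful Q' P; exists (r (q ∘ h)).
have [r' Er'] : exists r' : Hom Q' P', fmap F r' = q' ∘ h.
  by have [r' _ Kr] := coalg_incl_full_faithful Q' P'; exists (r' (q' ∘ h)).
have Ephi : phi P p ∘ fmap F r = phi P' p' ∘ fmap F r'.
  by rewrite -!hn_nat Er Er' !compcA (proj1 H).
have hlU : coalg_arr h ∘ coalg_arr l = idc (carrier Q).
  exact: (f_equal (@coalg_arr _ _ _ _) hl).
have Ek : k = coalg_arr (fmap F r) ∘ (coalg_arr l ∘ w).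
  by rewrite Er /= -compcA (compcA _ _ w) hlU comp1c qw.
have Ek' : k' = coalg_arr (fmap F r') ∘ (coalg_arr l ∘ w).
  by rewrite Er' /= -compcA (compcA _ _ w) hlU comp1c qw'.
rewrite Ek Ek' !compcA; congr (_ ∘ _ ∘ _).
exact: (f_equal (@coalg_arr _ _ _ _) Ephi).
Qed.

(** By [family_compat] the value at f does not depend on the factorization of f
    through a coalgebra map. *)
Lemma family_extend_sig (A : C) (f : Hom (i A) (carrier I)) :
  {x : Hom (i A) (carrier X) |
    forall (P : Coalg BoxC) (p : Hom (F P) I) (k : Hom (i A) (i (carrier P))),
      coalg_arr p ∘ k = f -> x = coalg_arr (phi P p) ∘ k}.
Proof.
apply: constructive_indefinite_description.
have [P [p [k E]]] := coalg_cover f.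
exists (coalg_arr (phi P p) ∘ k) => P' p' k' E'.
by apply: family_compat; rewrite E.
Qed.

Definition family_extend (A : C) (f : Hom (i A) (carrier I)) :
  Hom (i A) (carrier X) := proj1_sig (family_extend_sig f).

Lemma family_extendE (A : C) (P : Coalg BoxC) (p : Hom (F P) I)
    (k : Hom (i A) (i (carrier P))) :
  family_extend (coalg_arr p ∘ k) = coalg_arr (phi P p) ∘ k.
Proof. exact: (proj2_sig (family_extend_sig (coalg_arr p ∘ k))). Qed.

Lemma family_extend_nat (A B : C) (h : Hom A B) (f : Hom (i B) (carrier I)) :
  family_extend (f ∘ fmap i h) = family_extend f ∘ fmap i h.
Proof.
have [P [p [k <-]]] := coalg_cover f.
by rewrite -compcA !family_extendE compcA.
Qed.

(** Density of i represents the extended family by a map g; that g is a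
    homomorphism is tested on maps from objects of C, each of which factors
    through some p with g p = phi p a homomorphism. *)
Lemma family_represented :
  exists g : Hom I X, forall P (p : Hom (F P) I), g ∘ p = phi P p.
Proof.
have [r _ /(_ {| hn_nat := family_extend_nat |}) Kr] :=
  proj1 denseI (carrier I) (carrier X).
set g := r _ in Kr.
have Eg (A : C) (f : Hom (i A) (carrier I)) : g ∘ f = family_extend f.
  exact: (f_equal (fun h : HomNat i _ _ => h A f) Kr).
have Ep P (p : Hom (F P) I) : g ∘ coalg_arr p = coalg_arr (phi P p).
  have := family_extendE p (idc (i (carrier P))).
  by rewrite !compc1 -Eg.
have gP : fmap BoxD g ∘ coact I = coact X ∘ g.
  apply: (dense_ext (proj1 denseI)) => A f; have [P [p [k <-]]] := coalg_cover f.
  rewrite !compcA -(compcA (fmap BoxD g)) -coalg_arrP compcA -fmapM Ep.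
  by rewrite coalg_arrP -compcA -(compcA (coact X) g) Ep !compcA.
exists {| coalg_arrP := gP |} => P p; apply: coalg_hom_eq; exact: Ep.
Qed.

End Extend.

Lemma coalg_dense : dense_functor F.
Proof.
move=> I X.
have inj (g g' : Hom I X) :
    (forall P (p : Hom (F P) I), g ∘ p = g' ∘ p) -> g = g'.
  move=> E; apply: coalg_hom_eq; apply: (dense_ext (proj1 denseI)) => A f.
  have [P [p [k <-]]] := coalg_cover f.
  rewrite !compcA; congr (_ ∘ _).
  exact: (f_equal (@coalg_arr _ _ _ _) (E P p)).
pose r phi := proj1_sig (constructive_indefinite_description _
  (@family_represented I X phi)).
have rP phi P (p : Hom (F P) I) : r phi ∘ p = phi P p.
  by rewrite /r; case: constructive_indefinite_description.
exists r => [g | phi]; last by apply: homnat_ext => P p; apply: rP.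
by apply: inj => P p; rewrite rP.
Qed.

End Density.

(** * The inclusion of coalgebras is logical *)

Section Logical.
Hypotheses (heytC : heyting_category C) (heytD : heyting_category D).

Lemma coalg_incl_mono (A B : Coalg BoxC) (m : Hom A B) :
  mono m -> mono (fmap F m).
Proof. exact: (cartesian_mono coalg_incl_cartesian). Qed.

(** First for the dual image built as an interior, whose defining pullback i
    preserves up to the identification of i W with W i; then for any other, which
    is the same subobject. *)
Lemma coalg_incl_dual_image (A B S R : Coalg BoxC) (f : Hom A B)
    (s : Hom S A) (r : Hom R B) :
  mono s -> is_dual_image f s r ->
  is_dual_image (fmap F f) (fmap F s) (fmap F r).
Proof.
move=> Ms Hr.
have [R0 [r0 [R' [r' [q [H0 /coalg_pullback /= H Hr']]]]]] :=
  coalg_dual_image_exists heytC f Ms.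
(* The pullback in C is pasted with the naturality square of i W = W i. *)
have HF : is_dual_image (fmap F f) (fmap F s) (fmap F r').
  have Ms' := proj1 (coalg_mono s) Ms.
  apply: (@coalg_dual_image D BoxD (F A) (F B) (F S) (F R') (i R0) _ _
    (fmap i r0) _ (eq_hom (scm_ob Hs R0) ∘ fmap i (coalg_arr q))).
  - exact: coalg_incl_mono.
  - exact: (heyting_dual_image heytI).
  - apply: pullback_paste (cartesian_pullback (heyting_cartesian heytI) H).
    apply: (iso_pullback (@eq_hom_mono _ _ _ _) (eq_homK _) (eq_homVK _)).
    exact: (esym (scm_map Hs r0)).
have fac (Q Q' : Coalg BoxC) (a : Hom Q B) (b : Hom Q' B) :
    is_dual_image f s a -> is_dual_image f s b ->
    factors_through (fmap F a) (fmap F b).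
  move=> [Ma Ha] [Mb Hb].
  suff [h <-] : factors_through a b by rewrite fmapM; apply: factors_comp.
  have [P [p [p' Hp]]] := @pullback_exists (CartCoalg BoxC) _ _ _ f a.
  apply/(Hb _ _ _ _ _ Ma Hp)/(Ha _ _ _ _ _ Ma Hp).
  by exists (idc Q); rewrite compc1.
apply: (dual_image_factors HF); try exact: fac.
exact: coalg_incl_mono (proj1 Hr).
Qed.

Lemma coalg_heyting_functor : heyting_functor F.
Proof.
split.
- exact: coalg_incl_cartesian.
- move=> A B I f m /(coalg_image heytC) H; apply/(coalg_image heytD).
  exact: (heyting_image heytI).
- move=> X Z z /(coalg_bottom heytC) H; apply/(coalg_bottom heytD).
  exact: (heyting_bottom heytI).
- move=> X A B U m n u Mm Mn /(coalg_union heytC _ Mm Mn) H.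
  apply/(coalg_union heytD); try exact: coalg_incl_mono.
  by apply: (heyting_union heytI) => //; apply/coalg_mono.
- exact: coalg_incl_dual_image.
Qed.

(** It is enough that F preserves one generic monomorphism, since it is a
    pullback of every other.  The cofree one on t0 is sent by F, up to the
    identification of i W with W i, to the cofree one on i t0. *)
Lemma coalg_incl_generic (U V : Coalg BoxC) (t : Hom U V) :
  has_generic_mono C -> generic_mono t -> generic_mono (fmap F t).
Proof.
move=> [U0 [V0 [t0 Gt0]]] [Mt Gt].
have Mc : mono (cofree_hom BoxC t0) := proj1 (cofree_generic BoxC Gt0).
have [f [g H]] := Gt _ _ _ Mc.
apply: (generic_of_pullback (t' := fmap F (cofree_hom BoxC t0)) _
  (coalg_incl_mono Mt) (cartesian_pullback coalg_incl_cartesian H)).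
have G := cofree_generic BoxD (logical_generic logicalI Gt0).
(* The compatibility of i with comultiplications says that the identification of
   W (i A) with i (W A) is a homomorphism. *)
have eP (A : C) : fmap BoxD (eq_hom (esym (scm_ob Hs A))) ∘ comult BoxD (i A)
    = incl_coact Hs (cofree BoxC A) ∘ eq_hom (esym (scm_ob Hs A)).
  apply: (W_mono (@eq_hom_mono _ _ _ (scm_ob Hs A))).
  rewrite compcA -fmapM eq_homVK fmap1 comp1c /incl_coact /= !compcA.
  by rewrite -(scm_comult Hs) -compcA eq_homVK compc1.
pose e A : Hom (cofree BoxD (i A)) (F (cofree BoxC A)) :=
  {| coalg_arr := eq_hom (esym (scm_ob Hs A))
       : Hom (carrier (cofree BoxD (i A))) (carrier (F (cofree BoxC A)));
     coalg_arrP := eP A |}.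
apply: (generic_of_pullback (f := e V0) (g := e U0) G (coalg_incl_mono Mc)).
apply/coalg_pullback => /=.
apply: (iso_pullback (@eq_hom_mono _ _ _ _) (eq_homVK _) (eq_homK _)).
apply: (@eq_hom_mono _ _ _ (scm_ob Hs V0)).
by rewrite !compcA eq_homVK comp1c -(scm_map Hs) -compcA eq_homVK compc1.
Qed.

End Logical.
End Inclusion.

Theorem theoremA6 (C D : CartesianCategory)
    (heytC : heyting_category C) (genC : has_generic_mono C)
    (heytD : heyting_category D) (genD : has_generic_mono D)
    (BoxC : CartesianComonad C) (BoxD : CartesianComonad D)
    (i : ComonadInclusion BoxC BoxD)
    (denseI : dense_comonad_inclusion i)
    (logicalI : logical_comonad_inclusion i) :
  (heyting_category (CartCoalg BoxC) /\ has_generic_mono (CartCoalg BoxC)) /\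
  (heyting_category (CartCoalg BoxD) /\ has_generic_mono (CartCoalg BoxD)) /\
  cartesian_full_inclusion (coalg_inclusion i) /\
  dense_functor (coalg_inclusion i) /\
  logical_inclusion (coalg_inclusion i).
Proof.
split; first by split; [apply: coalg_heyting | apply: coalg_has_generic].
split; first by split; [apply: coalg_heyting | apply: coalg_has_generic].
split; first exact: coalg_incl_full.
split; first exact: coalg_dense logicalI genC denseI.
split; first exact: coalg_incl_full.
- exact: coalg_heyting_functor.
- by move=> U V t; apply: coalg_incl_generic.
Qed.
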